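(* For each integer $n\ge 2$, let $B_{2n+1}$ be the bouquet with edge set $\{1,2,\dots,2n+1\}$ and signed rotation $$(1,\,2,\,3,\,4,\,5,\,\dots,\,2n,\,2n+1,\,-1,\,2n,\,2n+1,\,\dots,\,4,\,5,\,2,\,3).$$ Then $B_{2n+1}$ is a counterexample to the statement ''the partial-dual Euler genus polynomial of every non-orientable ribbon graph is interpolating''; that is, $B_{2n+1}$ is a non-orientable ribbon graph and ${}^{\partial}\varepsilon_{B_{2n+1}}(z)$ is not interpolating.
   Context: A ribbon graph $G$ is a (possibly non-orientable) surface with boundary given as the union of vertex-discs $V(G)$ and edge-ribbons (discs) $E(G)$, where vertex-discs are pairwise disjoint, ribbons are pairwise disjoint, and each ribbon meets the vertex-discs in exactly two disjoint arcs (its ends, or half-edges), each lying on the boundary of exactly one vertex-disc. It is non-orientable if it is non-orientable as a surface. For a connected ribbon graph $G$ with $v$ vertices, $e$ edges and $f$ boundary components, the Euler genus $\varepsilon(G)$ is defined by $v-e+f=2-\varepsilon(G)$. For $A\subseteq E(G)$, the partial dual $G^A$ is the ribbon graph obtained by gluing a disc along each boundary component of the spanning ribbon subgraph $(V(G),A)$ (these discs are the vertices of $G^A$) and then removing the interiors of all original vertex-discs; its edges are the ribbons of $G$. The partial-dual Euler genus polynomial is ${}^{\partial}\varepsilon_G(z)=\sum_{A\subseteq E(G)}z^{\varepsilon(G^A)}$. A polynomial is interpolating if the set of exponents occurring with nonzero coefficient is an integer interval, i.e. consists of all integers between its minimum and its maximum. A bouquet is a ribbon graph with exactly one vertex. A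 signed rotation of a bouquet is the cyclic ordering of the half-edges around the vertex, each half-edge being written as the label of its edge together with a sign: the two half-edges of an edge get the same sign $+$ if the edge is an untwisted loop, and different signs (one $+$, one $-$) if it is a twisted loop. The sign $+$ is omitted. The signed rotation determines the bouquet. In the signed rotation of $B_{2n+1}$, after the entry $-1$ the pairs $2i,2i+1$ occur in decreasing order of $i$, from $i=n$ to $i=1$, with $2i$ immediately followed by $2i+1$ in each pair. Thus edge $1$ is twisted and all other edges are untwisted. *)

(* Defs.v *)
From HB Require Import structures.
From mathcomp Require Import all_boot all_order all_algebra.

Set Implicit Arguments.
Unset Strict Implicit.
Unset Printing Implicit Defensive.

Import Order.TTheory GRing.Theory Num.Theory.

(* A ribbon is a rectangle: two opposite sides are its ends (the arcs in which
   it meets the vertex-discs), the two others are its free sides.  Its four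
   corners are the triples (e, h, s): h tells at which end of e the corner lies,
   and s on which free side. *)
Definition corner (E : Type) : Type := (E * bool * bool)%type.

(* Runs along a free side of the ribbon, to the other end. *)
Definition along_side (E : Type) (c : corner E) : corner E :=
  let: (e, h, s) := c in (e, ~~ h, s).

(* Runs along an end of the ribbon, to the other free side. *)
Definition along_end (E : Type) (c : corner E) : corner E :=
  let: (e, h, s) := c in (e, h, ~~ s).

(* A ribbon graph, up to homeomorphism.  The ends of the ribbons cut the
   boundaries of the vertex-discs into arcs; "arc" maps each corner to the corner
   at the other extremity of the arc issued from it.  Vertex-discs meeting no
   ribbon have no corners, and are merely counted. *)
Record ribbon_graph := RibbonGraph {
  edge : finType;
  arc : corner edge -> corner edge;
  arcK : involutive arc;
  arc_neq : forall c, arc c != c;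
  isolated : nat
}.

(* Number of orbits of the monoid generated by fs; all the maps used below are
   involutions, so that these are the orbits of a group. *)
Definition norbits (T : finType) (fs : seq (T -> T)) : nat :=
  n_comp [rel x y | has (fun f : T -> T => f x == y) fs] T.

Section Invariants.
Variable G : ribbon_graph.

(* The boundary of a vertex-disc alternates arcs and ends of ribbons. *)
Definition nb_vertices : nat :=
  norbits [:: @arc G; @along_end (edge G)] + isolated G.

Definition nb_edges : nat := #|edge G|.

(* A boundary component of G alternates arcs and free sides of ribbons. *)
Definition nb_boundaries : nat :=
  norbits [:: @arc G; @along_side (edge G)] + isolated G.

Definition nb_components : nat :=
  norbits [:: @arc G; @along_end (edge G); @along_side (edge G)] + isolated G.

(* v - e + f = 2 k - euler_genus, with k = 1 when G is connected. *)
Definition euler_genus : int :=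
  (nb_components.*2%:Z - (nb_vertices%:Z - nb_edges%:Z + nb_boundaries%:Z))%R.

(* An orientation of a vertex-disc is recorded by the set of corners which its
   oriented boundary leaves along an end (rather than along an arc), and an
   orientation of a ribbon by the set of corners which its oriented boundary
   leaves along a free side (rather than along an end).  The value changes along
   each arc, end or free side.  Orientations of a vertex-disc and of a ribbon
   are coherent when they run through a common end in opposite directions, that
   is when the two conventions give the same values at its corners.  Thus o is a
   coherent orientation of the whole surface. *)
Definition orientable : Prop :=
  exists o : corner (edge G) -> bool, forall c,
    [/\ o (arc c) = ~~ o c, o (along_end c) = ~~ o c
      & o (along_side c) = ~~ o c].

(* The boundary components of the spanning ribbon subgraph (V(G), A) follow the
   arcs, the free sides of the ribbons in A, and the ends of the others.  These
   are the boundaries of the vertex-discs of the partial dual: for e in A the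
   free sides of e become its ends, and conversely, while the arcs do not
   change. *)
Definition swap_corner (A : {set edge G}) (c : corner (edge G)) :
    corner (edge G) :=
  let: (e, h, s) := c in if e \in A then (e, s, h) else (e, h, s).

Lemma swap_cornerK (A : {set edge G}) : involutive (swap_corner A).
Proof. by case=> [[e h] s] /=; case: ifP => /= ->. Qed.

Definition dual_arc (A : {set edge G}) (c : corner (edge G)) :
    corner (edge G) :=
  swap_corner A (arc (swap_corner A c)).

Lemma dual_arcK (A : {set edge G}) : involutive (dual_arc A).
Proof. by move=> c; rewrite /dual_arc swap_cornerK arcK swap_cornerK. Qed.

Lemma dual_arc_neq (A : {set edge G}) c : dual_arc A c != c.
Proof.
apply: contra (arc_neq (swap_corner A c)) => /eqP {2}<-.
by rewrite /dual_arc swap_cornerK.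
Qed.

Definition partial_dual (A : {set edge G}) : ribbon_graph :=
  RibbonGraph (dual_arcK A) (dual_arc_neq A) (isolated G).

End Invariants.

(* The Euler genus of a ribbon graph is nonnegative, so that taking its absolute
   value only casts it to nat. *)
Definition partial_dual_genus_poly (G : ribbon_graph) : {poly int} :=
  (\sum_(A : {set edge G}) 'X^ `|euler_genus (partial_dual A)|%N)%R.

Definition interpolating (p : {poly int}) : Prop :=
  exists a b : nat, forall k : nat, (p`_k != 0)%R = (a <= k <= b).

(* A signed rotation with labels 1, ..., N, each occurring twice up to sign, as a
   sequence of integers read cyclically. *)
Record signed_rotation (N : nat) := SignedRotation {
  half_edges :> seq int;
  half_edgesP :
    perm_eq [seq `|x|%N | x <- half_edges] (iota 1 N ++ iota 1 N)
}.

Section Bouquet.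
Variables (N : nat) (w : signed_rotation N).

Local Notation m := (size w).

(* The edge e : 'I_N carries the label e.+1. *)
Definition occurrences (e : nat) : seq nat :=
  [seq i <- iota 0 m | `|nth 0%R w i|%N == e.+1].

Definition negative (i : nat) : bool := (nth 0 w i < 0)%R.

(* Around the vertex, the half-edge in position i has two extremities: (i, false)
   met first, and (i, true) met last.  An arc of the boundary of the vertex-disc
   joins the last extremity of a half-edge to the first one of the next. *)
Definition next_extremity (p : nat * bool) : nat * bool :=
  let: (i, b) := p in
  if b then (i.+1 %% m, false) else ((i + m).-1 %% m, true).

(* The end h of the edge e is its first (h = false) or second (h = true)
   occurrence.  If both have the same sign (untwisted loop) a free side of e
   joins opposite extremities of the two half-edges; otherwise it joins
   extremities of the same kind. *)
Definition extremity_of (c : corner 'I_N) : nat * bool :=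
  let: (e, h, s) := c in
  let i := nth 0 (occurrences e) h in (i, s (+) h (+) negative i).

(* Inverse of extremity_of on the positions i < m; e0 is a default value,
   unused on these. *)
Definition corner_at (e0 : 'I_N) (p : nat * bool) : corner 'I_N :=
  let: (i, b) := p in
  let e := insubd e0 `|nth 0%R w i|.-1 in
  let h := i == nth 0 (occurrences e) 1 in
  (e, h, b (+) h (+) negative i).

Definition bouquet_arc (c : corner 'I_N) : corner 'I_N :=
  corner_at c.1.1 (next_extremity (extremity_of c)).

Lemma size_occurrences (e : 'I_N) : size (occurrences e) = 2.
Proof.
rewrite size_filter.
have -> : count (fun i => `|nth 0%R w i|%N == e.+1) (iota 0 m) =
          count_mem e.+1 [seq `|x|%N | x <- w].
  rewrite -[X in _ = count _ (map _ X)](mkseq_nth 0%R) /mkseq -map_comp.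
  by rewrite count_map; apply: eq_count => i /=.
have/permP-> := half_edgesP w.
by rewrite count_cat !count_uniq_mem ?iota_uniq // mem_iota add1n !ltnS ltn_ord.
Qed.

Lemma mem_occurrences (e i : nat) :
  (i \in occurrences e) = (`|nth 0%R w i|%N == e.+1) && (i < m).
Proof. by rewrite mem_filter mem_iota. Qed.

Lemma label_bounds i : i < m -> 0 < `|nth 0%R w i| <= N.
Proof.
move=> lti.
have : `|nth 0%R w i|%N \in [seq `|x|%N | x <- w].
  by apply: map_f; apply: mem_nth.
by rewrite (perm_mem (half_edgesP w)) mem_cat !mem_iota orbb add1n ltnS.
Qed.

Lemma extremity_lt c : (extremity_of c).1 < m.
Proof.
case: c => [[e h] s] /=.
have : nth 0 (occurrences e) h \in occurrences e.
  by apply: mem_nth; rewrite size_occurrences; case: h.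
by rewrite mem_occurrences => /andP[].
Qed.

Lemma extremity_ofK e0 c : corner_at e0 (extremity_of c) = c.
Proof.
case: c => [[e h] s] /=.
have ioc : nth 0 (occurrences e) h \in occurrences e.
  by apply: mem_nth; rewrite size_occurrences; case: h.
have /andP[/eqP lab _] := etrans (esym (mem_occurrences _ _)) ioc.
have -> : insubd e0 `|nth 0%R w (nth 0 (occurrences e) h)|.-1 = e.
  by apply: val_inj; rewrite val_insubd lab ltn_ord.
have -> : (nth 0 (occurrences e) h == nth 0 (occurrences e) 1) = h.
  by rewrite nth_uniq ?size_occurrences ?filter_uniq ?iota_uniq ?ltnS ?leq_b1 ?eqb1.
by congr (_, _, _); rewrite addbAC addbK addbK.
Qed.

Lemma corner_atK e0 p : p.1 < m -> extremity_of (corner_at e0 p) = p.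
Proof.
case: p => i b /= lti.
set e := insubd _ _.
have /andP[lab0 labN] := label_bounds lti.
have vale : e.+1 = `|nth 0%R w i|.
  by rewrite /e val_insubd; move: lab0 labN; case: absz => [|k] //= _ ->.
have ioc : i \in occurrences e by rewrite mem_occurrences lti vale eqxx.
have -> : nth 0 (occurrences e) (i == nth 0 (occurrences e) 1) = i.
  move: ioc (size_occurrences e); case: (occurrences e) => [|x [|y []]] //=.
  by rewrite !inE; case: (i =P y) => [->|_] //= /orP[/eqP|].
by congr (_, _); rewrite addbAC addbK addbK.
Qed.

Lemma corner_at_default e0 e1 p : p.1 < m -> corner_at e0 p = corner_at e1 p.
Proof. by move=> ltp; rewrite -{1}(corner_atK e1 ltp) extremity_ofK. Qed.

Lemma next_extremity_lt p : p.1 < m -> (next_extremity p).1 < m.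
Proof.
by case: p => i [] /= lti; rewrite ltn_mod (leq_trans _ lti).
Qed.

Lemma next_extremityK p : p.1 < m -> next_extremity (next_extremity p) = p.
Proof.
case: p => i b /= lti; have m0 : 0 < m by apply: leq_trans lti.
case: b => /=; congr (_, _).
  have [lt|ge] := ltnP i.+1 m.
    by rewrite (modn_small lt) addSn /= modnDr modn_small.
  have im : i.+1 = m by apply/eqP; rewrite eqn_leq lti ge.
  by rewrite -im modnn add0n modn_small.
have -> : (((i + m).-1 %% m).+1 %% m)%N = ((i + m).-1.+1 %% m)%N.
  by rewrite -addn1 modnDml addn1.
by rewrite prednK ?addn_gt0 ?m0 ?orbT // modnDr modn_small.
Qed.

Lemma bouquet_arcK : involutive bouquet_arc.
Proof.
move=> c; rewrite /bouquet_arc.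
have lt := next_extremity_lt (extremity_lt c).
by rewrite corner_atK // next_extremityK ?extremity_lt // extremity_ofK.
Qed.

Lemma bouquet_arc_neq c : bouquet_arc c != c.
Proof.
apply/eqP => /(congr1 extremity_of).
rewrite corner_atK ?next_extremity_lt ?extremity_lt //.
by case: (extremity_of c) => i [].
Qed.

(* The bouquet without edges is a single isolated vertex-disc. *)
Definition bouquet : ribbon_graph :=
  RibbonGraph bouquet_arcK bouquet_arc_neq (N == 0).

(* A bouquet has exactly one vertex. *)
Lemma bouquet_nb_vertices : nb_vertices bouquet = 1.
Proof.
rewrite /nb_vertices /norbits; set e := [rel x y | _].
have stepA c : connect e c (bouquet_arc c).
  by apply: connect1; rewrite /e /= eqxx.
have stepE c : connect e c (along_end c).
  by apply: connect1; rewrite /e /= eqxx orbT.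
have eE : connect_sym e.
  apply: sym_connect_sym => x y; rewrite /e /= !orbF.
  have endK : involutive (@along_end 'I_N) by case=> [[? ?] ?] /=; rewrite negbK.
  by congr (_ || _); rewrite eq_sym -inv_eq //; apply: bouquet_arcK.
have [N0|N0] := posnP N.
  have -> : isolated bouquet = 1 by rewrite /= N0.
  apply: (congr1 (addn^~ 1) (_ : _ = 0)).
  by apply: eq_card0 => -[[[i lti] h] s]; exfalso; rewrite N0 in lti.
have m0 : 0 < m.
  rewrite -(size_map (fun x : int => `|x|%N)) (perm_size (half_edgesP w)).
  by rewrite size_cat size_iota addn_gt0 N0.
have -> : isolated bouquet = 0 by rewrite /= eqn0Ngt N0.
rewrite addn0.
pose e0 := Ordinal N0; pose c0 := corner_at e0 (0, false).
have flip i b : along_end (corner_at e0 (i, b)) = corner_at e0 (i, ~~ b).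
  by rewrite /= !addNb.
have conn i b : i < m -> connect e c0 (corner_at e0 (i, b)).
  have addb i1 b1 : connect e c0 (corner_at e0 (i1, false)) ->
      connect e c0 (corner_at e0 (i1, b1)).
    case: b1 => // h; apply: connect_trans h _.
    by rewrite -[true]/(~~ false) -flip.
  elim: i b => [|i IHi] b lti; apply: addb => //.
  apply: connect_trans (IHi true (ltnW lti)) _.
  have := stepA (corner_at e0 (i, true)).
  rewrite /bouquet_arc corner_atK ?(ltnW lti) //=.
  rewrite [in X in connect _ _ X](modn_small lti).
  by rewrite -/(corner_at _ (i.+1, false)) (corner_at_default _ e0).
rewrite -(n_comp_connect eE c0); apply: eq_n_comp_r => c.
rewrite !inE -(extremity_ofK e0 c).
by case: (extremity_of c) (extremity_lt c) => i b /= /(conn _ b).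
Qed.

End Bouquet.

(* The pairs 2i, 2i+1, for i running through s. *)
Definition pairs (s : seq nat) : seq int :=
  flatten [seq [:: i.*2%:Z; i.*2.+1%:Z]%R | i <- s].

(* 1, 2, 3, ..., 2n, 2n+1, -1, 2n, 2n+1, ..., 2, 3 *)
Definition B_word (n : nat) : seq int :=
  [:: 1%R] ++ pairs (iota 1 n) ++ [:: (-1)%R] ++ pairs (rev (iota 1 n)).

Lemma absz_pairs k n :
  [seq `|x|%N | x <- pairs (iota k n)] = iota k.*2 n.*2.
Proof. by elim: n k => //= n IHn k; rewrite -/(pairs _) IHn. Qed.

Lemma perm_pairs_rev s : perm_eq (pairs (rev s)) (pairs s).
Proof. by apply/perm_flatten/perm_map; rewrite perm_rev. Qed.

Lemma B_wordP n :
  perm_eq [seq `|x|%N | x <- B_word n] (iota 1 n.*2.+1 ++ iota 1 n.*2.+1).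
Proof.
rewrite /B_word !map_cat absz_pairs /= perm_cons perm_cat2l perm_cons.
by rewrite (perm_trans (perm_map _ (perm_pairs_rev _))) ?absz_pairs.
Qed.

(* The bouquet with 2n+1 edges, written B_{2n+1}. *)
Definition B (n : nat) : ribbon_graph := bouquet (SignedRotation (B_wordP n)).

(* Main.v *)
Require Import Defs.
From mathcomp Require Import all_boot all_order all_algebra.
From mathcomp Require Import zify.

Set Implicit Arguments.
Unset Strict Implicit.
Unset Printing Implicit Defensive.

Import GRing.Theory Num.Theory.

(** For a set A of ribbons, both the vertices of G^A and the boundary components
    of the spanning subgraph (V(G), A) are the closed curves which follow the
    arcs of the vertex-discs, the free sides of the ribbons in A and the ends of
    the other ribbons; the boundary components of G^A are the same curves for the
    complement of A.  With f(A) such curves, a connected G has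
      euler_genus (G^A) = 2 - (f(A) - e + f(~: A)).

    For B_(2n+1), the edges come as the twisted loop 1, drawn horizontally, and n
    pairs {2i, 2i+1}, each having its two occurrences facing each other across
    this loop.  Hence the curves run along strands of levels 0, ..., n, level k
    lying between the pairs number k and k+1, with an upper and a lower strand at
    each level.  A pair contained in A or disjoint from A lets the upper strand
    and the lower strand through, whereas a pair split by A acts as a wall: on
    either side of it the upper strand is joined to the lower one.  The loop 1
    either closes the picture at both extremities, or, when it is in A, joins its
    left extremity to its right one with a twist, which merges the leftmost curve
    with the rightmost one if there is a wall, and the upper strands with the lower
    ones if there is none.  With s split pairs there are thus s + 1 curves when 1
    is not in A and max(s, 1) when 1 is in A (nb_traces_B).

    The complement of A splits the same pairs and exactly one of the two sets
    contains 1, so that the Euler genus is 2n + 1 when s = 0 and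
    2(n - s) + 2 when s > 0 (genus_B).  The values 2 and 2n + 1 are reached, but
    3 is not when n >= 2.  Non-orientability comes from the twisted loop alone
    (twisted_not_orientable). *)

(** * Orbits *)

Definition orbit_step (T : finType) (fs : seq (T -> T)) : rel T :=
  [rel x y | has (fun f : T -> T => f x == y) fs].

Lemma orbit_sym (T : finType) (fs : seq (T -> T)) :
  (forall x, all (fun f : T -> T => f (f x) == x) fs) ->
  connect_sym (orbit_step fs).
Proof.
move=> fsK; apply: sym_connect_sym.
have sub x y : orbit_step fs x y -> orbit_step fs y x.
  rewrite /orbit_step /=; elim: fs fsK => //= f fs IHfs fsK.
  case/orP=> [/eqP <-|fxy].
    by have /andP[-> _] := fsK x.
  by rewrite IHfs ?orbT // => z; have /andP[] := fsK z.
by move=> x y; apply/idP/idP; apply: sub.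
Qed.

(** A complete invariant of the orbits taking exactly the values 0, ..., k - 1
    numbers them. *)
Lemma norbits_count (T : finType) (fs : seq (T -> T)) (k : nat)
    (psi : T -> nat) :
  (forall x y, connect (orbit_step fs) x y = (psi x == psi y)) ->
  (forall x, psi x < k) -> (forall v, v < k -> exists x, psi x = v) ->
  norbits fs = k.
Proof.
move=> conP ltk surj; rewrite /norbits -/(orbit_step fs).
have symE : connect_sym (orbit_step fs).
  by move=> x y; rewrite !conP eq_sym.
pose f x : 'I_k := Ordinal (ltk x).
rewrite -[RHS]card_ord /n_comp_mem.
have -> : #|[predI roots (orbit_step fs) & T]|
            = #|[set x in roots (orbit_step fs)]|.
  by apply: eq_card => x; rewrite !inE andbT.
rewrite -(card_in_imset (f := f)).
  apply: eq_card => v; rewrite [RHS]inE; apply/imsetP.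
  have [x xv] := surj v (ltn_ord v).
  exists (fingraph.root (orbit_step fs) x).
    by rewrite inE; apply: roots_root.
  apply: val_inj => /=; rewrite -xv; apply/eqP; rewrite -conP.
  exact: connect_root.
move=> x y; rewrite !inE => /eqP rx /eqP ry [] /eqP.
by rewrite -conP -(root_connect symE) rx ry => /eqP.
Qed.

Lemma norbits1_connect (T : finType) (fs : seq (T -> T)) :
  norbits fs = 1 -> connect_sym (orbit_step fs) ->
  forall x y, connect (orbit_step fs) x y.
Proof.
move=> c1 symE x y; rewrite -(root_connect symE).
have /mem_card1[r rP] : #|[predI roots (orbit_step fs) & T]| = 1 by exact: c1.
have rootr z : fingraph.root (orbit_step fs) z = r.
  apply/eqP; rewrite -[_ == _]/(_ \in pred1 r) -rP inE andbT.
  exact: roots_root.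
by rewrite !rootr.
Qed.

Lemma norbits_conj (T : finType) (g : T -> T) (fs fs' : seq (T -> T)) :
  involutive g ->
  (forall x, all (fun f : T -> T => f (f x) == x) fs) ->
  (forall x, all (fun f : T -> T => f (f x) == x) fs') ->
  (forall x y, orbit_step fs (g x) (g y) = orbit_step fs' x y) ->
  norbits fs = norbits fs'.
Proof.
move=> gK fsK fsK' egg.
have symE := orbit_sym fsK; have symE' := orbit_sym fsK'.
apply: (@adjunction_n_comp T T g (orbit_step fs) (orbit_step fs') symE symE' T).
  by [].
apply: strict_adjunction => //; first exact: inv_inj.
by apply/subsetP => x _; rewrite -[x]gK codom_f.
Qed.

(** * Boundary curves of a spanning subgraph, and the genus of partial duals *)

Lemma along_sideK (E : Type) : involutive (@along_side E).
Proof. by case=> [[e h] s] /=; rewrite negbK. Qed.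

Lemma along_endK (E : Type) : involutive (@along_end E).
Proof. by case=> [[e h] s] /=; rewrite negbK. Qed.

(** The step, other than along an arc, of the boundary of the spanning subgraph
    with ribbons A: the ribbons outside A are deleted, so that their ends belong
    to the boundary. *)
Definition trace (E : finType) (A : {set E}) (c : corner E) : corner E :=
  if c.1.1 \in A then along_side c else along_end c.

Lemma traceK (E : finType) (A : {set E}) : involutive (trace A).
Proof.
case=> [[e h] s]; rewrite /trace /=.
by case eA: (e \in A); rewrite /= eA /= negbK.
Qed.

Section PartialDual.
Variable G : ribbon_graph.
Implicit Type A : {set edge G}.

Definition nb_traces A : nat := norbits [:: @Defs.arc G; trace A] + isolated G.

Lemma along_end_swap A c :
  along_end (swap_corner A c) = swap_corner A (trace A c).
Proof.
by case: c => [[e h] s]; rewrite /trace /=; case eA: (e \in A); rewrite /= eA.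
Qed.

Lemma along_side_swap A c :
  along_side (swap_corner A c) = swap_corner A (trace (~: A) c).
Proof.
case: c => [[e h] s]; rewrite /trace /= inE.
by case eA: (e \in A); rewrite /= eA.
Qed.

Lemma dual_arc_swap A c :
  dual_arc A (swap_corner A c) = swap_corner A (Defs.arc c).
Proof. by rewrite /dual_arc swap_cornerK. Qed.

Lemma swap_eq A c c' : (swap_corner A c == swap_corner A c') = (c == c').
Proof. exact/inj_eq/inv_inj/swap_cornerK. Qed.

(** Swapping the two coordinates of the corners of A conjugates along_end to
    trace A, along_side to trace (~: A), and the arcs of the partial dual to those
    of G; connectivity ignores the swap, since the two traces together are the
    end and side steps in some order. *)
Lemma euler_genus_partial_dual A :
  euler_genus (partial_dual A) =
    ((nb_components G).*2%:Z
       - ((nb_traces A)%:Z - (nb_edges G)%:Z + (nb_traces (~: A))%:Z))%R.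
Proof.
rewrite /euler_genus.
have -> : nb_vertices (partial_dual A) = nb_traces A.
  rewrite /nb_vertices /nb_traces; apply: (congr1 (addn^~ _)).
  apply: (@norbits_conj (corner (edge G)) (@swap_corner G A)).
  - exact: swap_cornerK.
  - by move=> c /=; rewrite dual_arcK along_endK !eqxx.
  - by move=> c /=; rewrite arcK traceK !eqxx.
  by move=> c c'; rewrite /orbit_step /= dual_arc_swap along_end_swap !swap_eq.
have -> : nb_boundaries (partial_dual A) = nb_traces (~: A).
  rewrite /nb_boundaries /nb_traces; apply: (congr1 (addn^~ _)).
  apply: (@norbits_conj (corner (edge G)) (@swap_corner G A)).
  - exact: swap_cornerK.
  - by move=> c /=; rewrite dual_arcK along_sideK !eqxx.
  - by move=> c /=; rewrite arcK traceK !eqxx.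
  by move=> c c'; rewrite /orbit_step /= dual_arc_swap along_side_swap !swap_eq.
have -> // : nb_components (partial_dual A) = nb_components G.
rewrite /nb_components; apply: (congr1 (addn^~ _)).
apply: (@norbits_conj (corner (edge G)) (@swap_corner G A)).
- exact: swap_cornerK.
- by move=> c /=; rewrite dual_arcK along_endK along_sideK !eqxx.
- by move=> c /=; rewrite arcK along_endK along_sideK !eqxx.
move=> c c'; rewrite /orbit_step /=.
rewrite dual_arc_swap along_end_swap along_side_swap !swap_eq.
rewrite /trace inE; case: ifP => //= _.
by rewrite !orbF; congr orb; rewrite orbC.
Qed.

End PartialDual.

(** * Bouquets *)

Section Bouquets.
Variables (N : nat) (w : signed_rotation N).

Lemma bouquet_vertex_connect (c c' : corner 'I_N) :
  connect (orbit_step [:: bouquet_arc w; @along_end 'I_N]) c c'.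
Proof.
have [N0|N0] := posnP N.
  by exfalso; case: c => [[[e elt] _] _]; rewrite N0 in elt.
apply: norbits1_connect.
  have := bouquet_nb_vertices w.
  by rewrite /nb_vertices /= eqn0Ngt N0 addn0.
by apply: orbit_sym => x /=; rewrite bouquet_arcK along_endK !eqxx.
Qed.

Lemma bouquet_nb_components : nb_components (bouquet w) = 1.
Proof.
rewrite /nb_components /=; have [N0|N0] := posnP N.
  apply: (congr1 (addn^~ 1) (_ : _ = 0)).
  by apply: eq_card0 => -[[[i lti] h] s]; exfalso; rewrite N0 in lti.
rewrite addn0; apply: (norbits_count (psi := fun=> 0)) => //.
  move=> c c'; rewrite eqxx.
  apply: connect_sub (bouquet_vertex_connect c c') => x y xy.
  apply: connect1; move: xy; rewrite /orbit_step /=.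
  by case/or3P=> // ->; rewrite ?orbT.
by case=> // _; exists (Ordinal N0, false, false).
Qed.

Lemma extremity_arc c :
  extremity_of w (bouquet_arc w c) = next_extremity w (extremity_of w c).
Proof. by rewrite corner_atK // next_extremity_lt // extremity_lt. Qed.

Lemma bouquet_arcP c c' :
  extremity_of w c' = next_extremity w (extremity_of w c) ->
  bouquet_arc w c = c'.
Proof.
rewrite -extremity_arc => /(congr1 (corner_at w c.1.1)).
by rewrite !extremity_ofK.
Qed.

(** A coherent orientation o changes along arcs and ends, exactly as the bit of
    extremity_of telling the first from the last extremity of a half-edge.  The
    single vertex makes their sum constant, but a free side of a twisted loop
    joins extremities of the same kind while it changes o. *)
Lemma twisted_not_orientable (e : 'I_N) :
  negative w (nth 0 (occurrences w e) 0)
    != negative w (nth 0 (occurrences w e) 1) ->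
  ~ orientable (bouquet w).
Proof.
move=> twist [o oP].
pose t c := o c (+) (extremity_of w c).2.
have tconst c c' : t c = t c'.
  have /connectP[p ep ->] := bouquet_vertex_connect c c'.
  elim: p c ep => //= d p IHp c /andP[cd /IHp <-]; rewrite /t.
  have [oa oe _] := oP c.
  case/orP: cd => [/eqP <-|/orP[/eqP <-|//]].
    rewrite extremity_arc; move: oa => /= ->.
    by case: (extremity_of w c) => i [] /=; case: (o c).
  rewrite oe; case: c {oa oe} => [[e' h] s] /=.
  by rewrite !addNb addbN negbK.
have [_ _ os] := oP (e, false, false).
have := tconst (e, false, false) (e, true, false).
rewrite /t; move: os => /= ->.
by case: (o _) twist; case: (negative _ _); case: (negative _ _).
Qed.

Lemma occurrences_eq (e p q : nat) :
  p < q -> q < size w -> `|nth 0%R w p|%N = e.+1 -> `|nth 0%R w q|%N = e.+1 ->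
  e < N -> occurrences w e = [:: p; q].
Proof.
move=> pq qm wp wq eN.
have := size_occurrences w (Ordinal eN) => /= sz.
have : sorted ltn (occurrences w e).
  by apply: sorted_filter (iota_ltn_sorted _ _); apply: ltn_trans.
have : p \in occurrences w e by rewrite mem_occurrences wp eqxx (ltn_trans pq).
have : q \in occurrences w e by rewrite mem_occurrences wq eqxx.
case: (occurrences w e) sz => [|x [|y []]] //= _; rewrite !inE.
case/orP=> /eqP qE /orP[] /eqP pE; rewrite -?qE -?pE //.
all: by rewrite ?andbT; lia.
Qed.

End Bouquets.

(** * Positions of the half-edges *)

Lemma size_pairs s : size (pairs s) = (size s).*2.
Proof. by elim: s => //= j s; rewrite -/(pairs s) => ->. Qed.

Lemma nth_pairs s i (b : bool) :
  i < size s -> nth 0%R (pairs s) (i.*2 + b) = Posz ((nth 0 s i).*2 + b).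
Proof.
elim: s i => [|j s IHs] [|i] //= lti.
  by case: b {IHs}; rewrite ?addn0 ?addn1.
by rewrite -/(pairs s) IHs.
Qed.

Section Strands.
Variable n : nat.

Local Notation N := n.*2.+1.
Local Notation w := (SignedRotation (B_wordP n)).

Lemma size_B_word : size (B_word n) = n.*2.+1.*2.
Proof. by rewrite /B_word !size_cat !size_pairs size_rev size_iota /=; lia. Qed.

Lemma B_word_top j (b : bool) :
  j < n -> nth 0%R (B_word n) (j.*2.+1 + b) = Posz (j.+1.*2 + b).
Proof.
move=> ltj; rewrite /B_word addSn /= nth_cat size_pairs size_iota.
have -> : j.*2 + b < n.*2 by case: b; lia.
by rewrite nth_pairs ?size_iota // nth_iota.
Qed.

Lemma B_word_bottom j (b : bool) :
  j < n -> nth 0%R (B_word n) ((n.*2 - j).*2 + b) = Posz (j.+1.*2 + b).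
Proof.
move=> ltj; rewrite /B_word.
have -> : (n.*2 - j).*2 + b = ((n - j.+1).*2 + b + n.*2).+2.
  by case: b; lia.
rewrite [_ ++ _]/= -[[:: _ & _]]/(_ :: _) /= nth_cat size_pairs size_iota.
rewrite ifN; last by lia.
rewrite -addSn addnK /= nth_pairs ?size_rev ?size_iota; last by lia.
rewrite nth_rev ?size_iota; last by lia.
by rewrite nth_iota; [congr (Posz _); lia | lia].
Qed.

Lemma B_word_middle : nth 0%R (B_word n) N = (-1)%R.
Proof.
rewrite /B_word /= nth_cat size_pairs size_iota.
by rewrite ltnn subnn.
Qed.

(** Pairs are numbered from 0: pair_edge j b carries the label 2(j + 1) + b. *)
Definition pair_edge j (b : bool) : 'I_N := inord (j.*2.+1 + b).

Lemma val_pair_edge j (b : bool) :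
  j < n -> pair_edge j b = (j.*2.+1 + b)%N :> nat.
Proof. by move=> ltj; rewrite inordK //; case: b; lia. Qed.

Lemma pair_edge_neq0 j b : j < n -> pair_edge j b != ord0.
Proof. by move=> ltj; rewrite -val_eqE /= val_pair_edge. Qed.

Lemma edge_ind (P : 'I_N -> Prop) :
  P ord0 -> (forall j b, j < n -> P (pair_edge j b)) -> forall e, P e.
Proof.
move=> P0 Pj [[|i] lti].
  by have -> : Ordinal lti = ord0 by apply: val_inj.
have -> : Ordinal lti = pair_edge i./2 (odd i).
  apply: ord_inj; rewrite val_pair_edge /=; last by lia.
  by rewrite addSn addnC odd_double_half.
by apply: Pj; lia.
Qed.

Lemma occurrences_twisted : occurrences w (@ord0 n.*2) = [:: 0; N].
Proof.
apply: occurrences_eq => //; first by rewrite size_B_word; lia.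
by rewrite B_word_middle.
Qed.

Lemma occurrences_pair j (b : bool) : j < n ->
  occurrences w (pair_edge j b) = [:: j.*2.+1 + b; (n.*2 - j).*2 + b].
Proof.
move=> ltj; rewrite val_pair_edge //.
apply: occurrences_eq; rewrite ?size_B_word ?B_word_top ?B_word_bottom //.
all: by case: b; lia.
Qed.

Lemma extremity_twisted (h s : bool) :
  extremity_of w (ord0, h, s) = (if h then N else 0, s).
Proof.
rewrite /extremity_of occurrences_twisted /negative.
by case: h; rewrite [nth 0 _ _]/= ?B_word_middle; case: s.
Qed.

Lemma extremity_pair j (b h s : bool) : j < n ->
  extremity_of w (pair_edge j b, h, s) =
    (if h then (n.*2 - j).*2 + b else j.*2.+1 + b, s (+) h).
Proof.
move=> ltj; rewrite /extremity_of occurrences_pair // /negative.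
by case: h; rewrite [nth 0 _ _]/= ?B_word_top ?B_word_bottom ?addbF.
Qed.

Lemma B_not_orientable : ~ orientable (B n).
Proof.
apply: (@twisted_not_orientable _ _ ord0).
by rewrite occurrences_twisted /negative [nth 0 _ 1]/= B_word_middle.
Qed.

(** * Strands *)

(** With the twisted loop drawn horizontally, its first end on the left, the
    strand of level k is bordered on its left by the pair number k - 1, or the
    first end of the loop when k = 0, and on its right by the pair number k, or
    the second end of the loop when k = n.  The strand is an arc, the upper one
    for b = false and the lower one for b = true: west k b and east k b are its
    extremities.  Since the second occurrences are read from right to left, the
    lower copy of a pair has its two edges exchanged.  For the pairs, the last
    coordinate s of a corner tells the right side of the half-edge from its left
    side. *)
Definition west (k : nat) (b : bool) : corner 'I_N :=
  if k is j.+1 then (pair_edge j (~~ b), b, true) else (ord0, false, ~~ b).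

Definition east (k : nat) (b : bool) : corner 'I_N :=
  if k == n then (ord0, true, b) else (pair_edge k b, b, false).

Lemma east_pair j b : j < n -> east j b = (pair_edge j b, b, false).
Proof. by move=> ltj; rewrite /east ltn_eqF. Qed.

Lemma next_extremity_true i : i.+1 < n.*2.+1.*2 ->
  next_extremity w (i, true) = (i.+1, false).
Proof. by move=> lti; rewrite /next_extremity size_B_word modn_small. Qed.

Lemma arc_top k : k <= n -> bouquet_arc w (west k false) = east k false.
Proof.
move=> lek; apply: bouquet_arcP.
have -> : extremity_of w (west k false) = (k.*2, true).
  case: k lek => [|j] ltj; first by rewrite extremity_twisted.
  by rewrite extremity_pair // addn1 -doubleS.
rewrite next_extremity_true; last by lia.
move: lek; rewrite /east leq_eqVlt; case: eqP => [-> _|_].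
  by rewrite extremity_twisted.
rewrite orFb => ltk.
by rewrite extremity_pair // addn0.
Qed.

(** The lower strands are read from east to west. *)
Lemma arc_bottom k : k <= n -> bouquet_arc w (west k true) = east k true.
Proof.
move=> lek; rewrite -[RHS](@bouquet_arcK _ w); congr bouquet_arc; symmetry.
apply: bouquet_arcP.
have -> : extremity_of w (east k true) = ((n.*2 - k).*2.+1, true).
  move: lek; rewrite /east leq_eqVlt; case: eqP => [-> _|_].
    by rewrite extremity_twisted; congr (_, _); lia.
  rewrite orFb => ltk.
  by rewrite extremity_pair // addn1.
case: k lek => [|j] ltj.
  by rewrite /next_extremity size_B_word extremity_twisted subn0 -doubleS modnn.
rewrite next_extremity_true; last by lia.
by rewrite /west extremity_pair //; congr (_, _); lia.
Qed.

Lemma arc_west k b : k <= n -> bouquet_arc w (west k b) = east k b.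
Proof. by case: b; [apply: arc_bottom | apply: arc_top]. Qed.

(** The arc between the two half-edges of a pair, for either occurrence. *)
Lemma arc_inner j h : j < n ->
  bouquet_arc w (pair_edge j false, h, ~~ h) = (pair_edge j true, h, h).
Proof.
move=> ltj; apply: bouquet_arcP; rewrite !extremity_pair // addbb addNb addbb.
by rewrite next_extremity_true; [congr (_, _); case: h; lia | case: h; lia].
Qed.

(** Every corner is an extremity of a strand or of an inner arc. *)
Lemma corner_ind (P : corner 'I_N -> Prop) :
  (forall k b, k <= n -> P (west k b)) ->
  (forall k b, k <= n -> P (east k b)) ->
  (forall j h, j < n -> P (pair_edge j false, h, ~~ h)) ->
  (forall j h, j < n -> P (pair_edge j true, h, h)) -> forall c, P c.
Proof.
move=> Pw Pe Pf Ps [[e h] s]; elim/edge_ind: e => [|j b ltj].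
  case: h; last by have := Pw 0 (~~ s) isT; rewrite /= negbK.
  by have := Pe n s (leqnn n); rewrite /east eqxx.
case: (boolP (s == h (+) b)) => [/eqP ->|].
  have := Pw j.+1 h ltj; have := Pe j h (ltnW ltj); rewrite east_pair //=.
  have := Pf j h ltj; have := Ps j h ltj.
  by case: b; case: h.
have := Pw j.+1 h ltj; have := Pe j h (ltnW ltj); rewrite east_pair //=.
have := Pf j h ltj; have := Ps j h ltj.
by case: b; case: h; case: s.
Qed.

(** * Counting the curves of B_(2n+1) *)

Section Traces.
Variable A : {set 'I_N}.

Definition split_pair j :=
  (pair_edge j false \in A) (+) (pair_edge j true \in A).

(** Number of walls on the left of the strands of level k. *)
Definition cuts k : nat := \sum_(j < k) split_pair j.

Lemma cutsS k : cuts k.+1 = cuts k + split_pair k.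
Proof. by rewrite /cuts big_ord_recr. Qed.

Lemma cuts0 : cuts 0 = 0.
Proof. by rewrite /cuts big_ord0. Qed.

Lemma cuts_mono k l : k <= l -> cuts k <= cuts l.
Proof.
elim: l => [|l IHl]; first by rewrite leqn0 => /eqP ->.
rewrite leq_eqVlt => /predU1P[-> //|/IHl le].
by rewrite cutsS (leq_trans le) ?leq_addr.
Qed.

Lemma cuts_le k : cuts k <= k.
Proof.
by elim: k => [|k IHk]; rewrite ?cuts0 // cutsS -addn1 leq_add // leq_b1.
Qed.

(** The values of cuts increase by at most 1 at each step. *)
Lemma cuts_onto l v : v <= cuts l -> exists2 k, k <= l & cuts k = v.
Proof.
elim: l => [|l IHl] lev.
  by exists 0 => //; move: lev; rewrite cuts0; case: v.
have [le|gt] := leqP v (cuts l).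
  by have [k lek <-] := IHl le; exists k => //; apply: leqW.
exists l.+1 => //; apply/eqP; rewrite eqn_leq lev andbT cutsS.
by case: (split_pair l); rewrite ?addn0 ?addn1 // ltnW.
Qed.

(** The level of a strand reached from the corner c.  A free side of a ribbon of a
    pair leads to its other occurrence and keeps s, which thus tells the side of
    the pair where the curve comes out.  A ribbon outside A is skipped, and the
    curve leaves the pair on the side where this ribbon is: for the first edge of
    a pair, the left above (h = false) and the right below; for the second edge,
    the other way round. *)
Definition level (c : corner 'I_N) : nat :=
  let: (e, h, s) := c in
  if e == ord0 then h * n
  else e.-1./2 + (if e \in A then s else ~~ odd e (+) h).

Lemma level_pair j b h s : j < n ->
  level (pair_edge j b, h, s) =
    j + (if pair_edge j b \in A then s else b (+) h).
Proof.
move=> ltj; rewrite /level (negbTE (pair_edge_neq0 _ _)) // val_pair_edge //.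
congr (_ + _); first by case: b; lia.
by case: ifP => // _; rewrite addSn /= negbK oddD odd_double; case: b.
Qed.

Lemma level_west k b : k <= n -> level (west k b) = k.
Proof.
case: k => [|j] ltj //=; rewrite -/(level (_, _, _)) level_pair //.
by case: b; rewrite if_same addn1.
Qed.

Lemma level_east k b : k <= n -> level (east k b) = k.
Proof.
rewrite leq_eqVlt /east; case: eqP => [->|_] /= ltk; first by rewrite mul1n.
by rewrite -/(level (_, _, _)) level_pair // addbb if_same addn0.
Qed.

Lemma level_le c : level c <= n.
Proof.
case: c => [[e h] s]; elim/edge_ind: e => [|j b ltj].
  by rewrite /level eqxx; case: h; rewrite ?mul1n.
by rewrite level_pair //; case: ifP => _; case: s; case: b; case: h => /=; lia.
Qed.

(** The two extremities of an inner arc have different levels only for a pair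
    contained in A or disjoint from it, which is no wall. *)
Lemma cuts_level_arc c : cuts (level (bouquet_arc w c)) = cuts (level c).
Proof.
have inner j h : j < n ->
    cuts (level (pair_edge j false, h, ~~ h))
    = cuts (level (pair_edge j true, h, h)).
  move=> ltj; rewrite !level_pair // addFb addTb.
  have := cutsS j; rewrite /split_pair.
  case: (_ \in A); case: (_ \in A) => //=; rewrite addn0 => eC;
    by case: h; rewrite ?addn0 ?addn1 ?eC.
elim/corner_ind: c => [k b lek|k b lek|j h ltj|j h ltj].
- by rewrite arc_west // level_west // level_east.
- by rewrite -arc_west // bouquet_arcK arc_west // level_west // level_east.
- by rewrite arc_inner // inner.
- by rewrite -arc_inner // bouquet_arcK inner // arc_inner.
Qed.

Lemma level_trace_pair j b h s : j < n ->
  level (trace A (pair_edge j b, h, s)) = level (pair_edge j b, h, s).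
Proof.
move=> ltj; rewrite /trace [_.1.1]/= /along_side /along_end.
by case: ifP => eA; rewrite !level_pair // eA.
Qed.

Local Notation conn := (connect (orbit_step [:: bouquet_arc w; trace A])).

Lemma conn_sym : connect_sym (orbit_step [:: bouquet_arc w; trace A]).
Proof. by apply: orbit_sym => c /=; rewrite bouquet_arcK traceK !eqxx. Qed.

Lemma conn_arc c : conn c (bouquet_arc w c).
Proof. by apply: connect1; rewrite /orbit_step /= eqxx. Qed.

Lemma conn_trace c : conn c (trace A c).
Proof. by apply: connect1; rewrite /orbit_step /= eqxx orbT. Qed.

Lemma conn_east k b : k <= n -> conn (west k b) (east k b).
Proof. by move=> lek; rewrite -arc_west ?conn_arc. Qed.

(** One trace step from either extremity of an inner arc leaves the pair; the next
    two lemmas tell through which strand. *)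
Lemma conn_inner j h : j < n ->
  conn (trace A (pair_edge j false, h, ~~ h)) (trace A (pair_edge j true, h, h)).
Proof.
move=> ltj; apply: (@connect_trans _ _ (pair_edge j false, h, ~~ h)).
  by rewrite conn_sym conn_trace.
by apply: connect_trans (conn_arc _) _; rewrite arc_inner ?conn_trace.
Qed.

Lemma trace_first j h : j < n ->
  let g := h (+) (pair_edge j false \in A) in
  trace A (pair_edge j false, h, ~~ h)
  = if g then west j.+1 true else east j false.
Proof.
move=> ltj; rewrite /trace /= east_pair //.
by case: ifP => _; case: h.
Qed.

Lemma trace_second j h : j < n ->
  let g := h (+) (pair_edge j true \in A) in
  trace A (pair_edge j true, h, h) = if g then east j true else west j.+1 false.
Proof.
move=> ltj; rewrite /trace /= east_pair //.
by case: ifP => _; case: h.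
Qed.

(** The inner arc to use is the one whose first edge is left through a strand of
    the same kind b: east j b if b = false, west j.+1 b if b = true.  As the pair is
    not split, its second edge is left through the facing strand of this kind. *)
Lemma conn_pass j b : j < n -> ~~ split_pair j -> conn (west j b) (west j.+1 b).
Proof.
move=> ltj; rewrite /split_pair => nsplit.
apply: connect_trans (conn_east b (ltnW ltj)) _.
have := conn_inner (b (+) (pair_edge j false \in A)) ltj.
rewrite trace_first // trace_second //.
case: (_ \in A) nsplit; case: (_ \in A) => // _;
  case: b => //= h; by rewrite // conn_sym.
Qed.

Lemma conn_turn j : j < n -> split_pair j ->
  conn (west j false) (west j true) /\ conn (west j.+1 false) (west j.+1 true).
Proof.
move=> ltj; rewrite /split_pair => isplit.
have T b := conn_east b (ltnW ltj).
have := conn_inner true ltj; have := conn_inner false ltj.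
rewrite !trace_first // !trace_second //.
case: (_ \in A) isplit; case: (_ \in A) => //= _ h1 h2.
all: split; rewrite 1?conn_sym //.
all: apply: connect_trans (T _) _; rewrite conn_sym; apply: connect_trans (T _) _.
all: by rewrite // conn_sym.
Qed.

(** Across a pair which is no wall both strands are carried along; next to a wall
    both sides hold. *)
Lemma joinedS j : j < n ->
  conn (west j false) (west j true) = conn (west j.+1 false) (west j.+1 true).
Proof.
move=> ltj; case: (boolP (split_pair j)) => [/(conn_turn ltj)[-> ->] //|nsplit].
rewrite (same_connect conn_sym (conn_pass false ltj nsplit)).
by rewrite (same_connect_r conn_sym (conn_pass true ltj nsplit)).
Qed.

Lemma conn_cuts b k l : k <= l -> l <= n -> cuts k = cuts l ->
  conn (west k b) (west l b).
Proof.
elim: l => [|l IHl]; first by rewrite leqn0 => /eqP ->.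
rewrite leq_eqVlt => /predU1P[-> //|lekl ltl eC].
have Ckl : cuts k <= cuts l by exact: cuts_mono.
move: eC; rewrite cutsS.
case: (boolP (split_pair l)) => [_|nsplit]; first by rewrite addn1; lia.
rewrite addn0 => eC.
exact: connect_trans (IHl lekl (ltnW ltl) eC) (conn_pass b ltl nsplit).
Qed.

Lemma east_n b : east n b = (ord0, true, b).
Proof. by rewrite /east eqxx. Qed.

Lemma conn_twisted b : ord0 \in A -> conn (west 0 (~~ b)) (west n b).
Proof.
move=> A0; rewrite conn_sym; apply: connect_trans (conn_east _ (leqnn n)) _.
have -> : west 0 (~~ b) = trace A (east n b).
  by rewrite east_n /trace /= A0 negbK.
exact: conn_trace.
Qed.

(** By joinedS one level suffices: the left extremity if the loop 1 is not in A; a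
    wall, if there is one; otherwise all the levels communicate, and the twist of
    the loop 1 sends the upper strand to the lower one. *)
Lemma joined k : k <= n -> conn (west k false) (west k true).
Proof.
have all0 l : l <= n ->
    conn (west l false) (west l true) = conn (west 0 false) (west 0 true).
  by elim: l => // l IHl ltl; rewrite -joinedS // IHl // ltnW.
move=> lek; rewrite all0 //.
case: (boolP (ord0 \in A)) => A0.
  case: (posnP (cuts n)) => [C0|Cpos].
    rewrite conn_sym; apply: connect_trans (conn_twisted false A0) _.
    by rewrite conn_sym; apply: conn_cuts; rewrite // cuts0.
  have [[j ltj] /= sj] : exists j : 'I_n, split_pair j.
    apply/existsP; apply: contraTT Cpos; rewrite negb_exists => /forallP ns.
    by rewrite -eqn0Ngt /cuts big1 // => j _; rewrite (negbTE (ns j)).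
  by rewrite -(all0 j (ltnW ltj)); have [] := conn_turn ltj sj.
rewrite conn_sym; have := conn_trace (west 0 true).
by rewrite /trace /= (negbTE A0).
Qed.

Lemma conn_west k b b' : k <= n -> conn (west k b) (west k b').
Proof.
move=> /joined J; case: b; case: b' => //; by rewrite // conn_sym.
Qed.

Lemma conn_level c : conn c (west (level c) false).
Proof.
elim/corner_ind: c => [k b lek|k b lek|j h ltj|j h ltj].
- by rewrite level_west // conn_west.
- rewrite level_east // conn_sym; apply: connect_trans (conn_east b lek).
  exact: conn_west.
- apply: connect_trans (conn_trace _) _.
  rewrite -level_trace_pair // trace_first //.
  case: ifP => _; first by rewrite level_west // conn_west.
  by rewrite level_east ?(ltnW ltj) // conn_sym conn_east // ltnW.
- apply: connect_trans (conn_trace _) _.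
  rewrite -level_trace_pair // trace_second //.
  case: ifP => _; last by rewrite level_west // conn_west.
  rewrite level_east ?(ltnW ltj) // conn_sym.
  apply: connect_trans (conn_east _ (ltnW ltj)).
  exact/conn_west/ltnW.
Qed.

Lemma conn_invariant (X : eqType) (psi : corner 'I_N -> X) :
  (forall c, psi (bouquet_arc w c) = psi c) ->
  (forall c, psi (trace A c) = psi c) ->
  forall c d, conn c d -> psi c = psi d.
Proof.
move=> arcP traceP c d /connectP[p ep ->].
elim: p c ep => //= d' p IHp c /andP[cd /IHp <-].
by case/or3P: cd => // /eqP <-.
Qed.

Lemma conn_same_cuts c d : cuts (level c) = cuts (level d) -> conn c d.
Proof.
move=> eC; apply: connect_trans (conn_level c) _; rewrite conn_sym.
apply: connect_trans (conn_level d) _.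
case: (leqP (level c) (level d)) => [le|/ltnW le].
  by rewrite conn_sym; apply: conn_cuts => //; apply: level_le.
by apply: conn_cuts => //; apply: level_le.
Qed.

(** When the loop 1 is in A, the strands on the right of all the walls communicate
    with those on the left of all of them. *)
Lemma conn_level_mod c : ord0 \in A ->
  exists k,
    [/\ k <= n, conn c (west k false) & cuts k = cuts (level c) %% cuts n].
Proof.
move=> A0; have := cuts_mono (level_le c).
rewrite leq_eqVlt => /predU1P[eC|ltC].
  exists 0; split=> //; last by rewrite eC modnn cuts0.
  apply: connect_trans (_ : conn (west n false) _).
    by apply: conn_same_cuts; rewrite level_west.
  rewrite conn_sym; apply: connect_trans (conn_twisted false A0).
  exact: joined.
exists (level c); split; [exact: level_le | exact: conn_level |].
by rewrite modn_small.
Qed.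

Lemma nb_traces_B :
  nb_traces (G := B n) A =
    if ord0 \in A then maxn (cuts n) 1 else (cuts n).+1.
Proof.
rewrite /nb_traces addn0.
case: (boolP (ord0 \in A)) => A0.
  apply: (@norbits_count (corner 'I_N) _ _ (fun c => cuts (level c) %% cuts n)).
  - move=> c d; apply/idP/eqP => [|eC].
      apply: (conn_invariant (psi := fun c => cuts (level c) %% cuts n)).
        by move=> {}c; rewrite cuts_level_arc.
      move=> [[e h] s]; elim/edge_ind: e => [|j b ltj]; last first.
        by rewrite level_trace_pair.
      rewrite /trace /= A0 /=.
      by case: h; rewrite /= ?mul1n ?mul0n cuts0 modnn mod0n.
    have [k [lek ck kE]] := conn_level_mod c A0.
    have [l [lel dl lE]] := conn_level_mod d A0.
    apply: connect_trans ck _; rewrite conn_sym; apply: connect_trans dl _.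
    by apply: conn_same_cuts; rewrite !level_west // kE lE.
  - move=> c; have := cuts_mono (level_le c).
    case: (posnP (cuts n)) => [->|Cpos]; first by rewrite leqn0 => /eqP ->.
    by rewrite leq_max ltn_pmod.
  - move=> v ltv; have lev : v <= cuts n.
      by move: ltv; rewrite leq_max; case/orP; lia.
    have [k lek kE] := cuts_onto lev; exists (west k false).
    rewrite level_west // kE.
    move: ltv; rewrite leq_max => /orP[/modn_small //|].
    by rewrite ltnS leqn0 => /eqP ->; rewrite mod0n.
apply: (@norbits_count (corner 'I_N) _ _ (fun c => cuts (level c))).
- move=> c d; apply/idP/eqP => [|]; last exact: conn_same_cuts.
  apply: (conn_invariant (psi := fun c => cuts (level c))).
    by move=> {}c; rewrite cuts_level_arc.
  move=> [[e h] s]; elim/edge_ind: e => [|j b ltj]; last first.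
    by rewrite level_trace_pair.
  by rewrite /trace /= (negbTE A0).
- by move=> c; rewrite ltnS cuts_mono // level_le.
move=> v; rewrite ltnS => /cuts_onto[k lek <-].
by exists (west k false); rewrite level_west.
Qed.

End Traces.

(** * The genera of the partial duals *)

Lemma cutsC A k : k <= n -> cuts (~: A) k = cuts A k.
Proof.
move=> lek; apply: eq_bigr => j _; rewrite /split_pair !inE.
by case: (_ \in A); case: (_ \in A).
Qed.

Lemma genus_B A :
  `|euler_genus (@partial_dual (B n) A)|%N =
    if cuts A n == 0 then n.*2.+1 else (n - cuts A n).*2.+2.
Proof.
have sn := cuts_le A n.
rewrite euler_genus_partial_dual bouquet_nb_components !nb_traces_B cutsC //.
rewrite /nb_edges card_ord inE.
by case: (ord0 \in A) => /=; case: eqP => [->|]; lia.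
Qed.

End Strands.

Lemma coef_genus_poly (G : ribbon_graph) k :
  reflect (exists A : {set edge G}, `|euler_genus (partial_dual A)|%N = k)
    ((partial_dual_genus_poly G)`_k != 0)%R.
Proof.
rewrite /partial_dual_genus_poly coef_sum.
under eq_bigr => A _ do rewrite coefXn.
rewrite -natr_sum pnatr_eq0 sum_nat_eq0 negb_forall.
apply: (iffP existsP) => -[A eA]; exists A; move: eA.
all: by rewrite eqb0 negbK eq_sym => /eqP.
Qed.

Theorem mainTheorem3 (n : nat) (hn : 2 <= n) :
  ~ orientable (B n) /\ ~ interpolating (partial_dual_genus_poly (B n)).
Proof.
split; first exact: B_not_orientable.
move=> [a [b ab]].
have top : a <= n.*2.+1 <= b.
  rewrite -ab; apply/coef_genus_poly; exists set0; rewrite genus_B.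
  by rewrite /cuts big1 // => j _; rewrite /split_pair !inE.
(* Odd indices are the first edges of the pairs, so that all pairs are split. *)
have bottom : a <= 2 <= b.
  rewrite -ab; apply/coef_genus_poly; exists [set e : 'I_n.*2.+1 | odd e].
  rewrite genus_B; have -> : cuts [set e : 'I_n.*2.+1 | odd e] n = n.
    rewrite -[RHS]card_ord -sum1_card /cuts; apply: eq_bigr => j _.
    by rewrite /split_pair !inE !val_pair_edge // addn0 addn1 /= odd_double.
  by case: eqP hn => [-> //|_ _]; rewrite subnn.
have : a <= 3 <= b by lia.
rewrite -ab => /coef_genus_poly[A]; rewrite genus_B.
by case: eqP; lia.
Qed.
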